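(* Fix $q,w_1,w_2>0$ and consider the two-community graph $\mathcal{K}_{2N}(w_1,w_2)$. Let $T_q\ge 1$ be a geometric random variable with success parameter $$\xi_{q,N}:=\frac{q}{q+N(w_1+w_2)},$$ i.e. $\mathbb{P}(T_q=n)=\xi_{q,N}(1-\xi_{q,N})^{n-1}$ for $n\ge1$, and let $\tilde X=(\tilde X_n)_{n\in\mathbb{N}_0}$ be a discrete-time Markov chain with state space $\{\underline{1},\underline{2}\}$ and transition matrix $$\tilde P=\begin{pmatrix}p&1-p\\1-p&p\end{pmatrix},\qquad p=\frac{w_1}{w_1+w_2}.$$ Let $\ell(n)=\sum_{0\le m<n}\mathbf{1}_{\{\tilde X_m=\underline{1}\}}$ be the local time in state $\underline{1}$ up to time $n$, and let $\tilde{\mathbb{P}}_{\underline{1}}$ be the law of $\tilde X$ started from $\underline{1}$. Let $x\in[N]$ and $y\neq x$; set $\star=in$ if $y\in[N]$ and $\star=out$ if $y\in[2N]\setminus[N]$. Then the pairwise LEP-interaction potential satisfies $$U^{(N)}_q(x,y)=U^{(N)}_q(\star):=\sum_{n\ge1}\mathbb{P}(T_q=n)\sum_{k=1}^{n}\tilde{\mathbb{P}}_{\underline{1}}(\ell(n)=k)\,N^{-n+1}\,\hat f_\star(n,k)\,\theta(n,k)\,P^\dagger_\star(n,k),$$ where $$\hat f_{out}(n,k)=(N-1)_{k-1}(N-1)_{n-k},\qquad \hat f_{in}(n,k)=(N-2)_{k-1}(N)_{n-k},$$ $$\theta(n,k)=\frac{(q-\lambda_1(n,k))(q-\lambda_2(n,k))}{q(q+2Nw_2)},$$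 with, for $i=1,2$, $$\lambda_i(n,k)=-\frac12\left[w_1n+2w_2N+(-1)^i\sqrt{w_1^2(2k-n)^2+4(N-k)(N-n+k)w_2^2}\right],$$ and $$P^\dagger_\star(n,k)=\frac{q\,\bigl(q+k_\star(w_1-w_2)+2w_2N\bigr)}{[q+kw_1][q+(n-k)w_1]+Nw_2(2q+nw_1)+w_2^2[Nn-k(n-k)]},\qquad k_\star=\begin{cases}k,&\star=out,\\ n-k,&\star=in.\end{cases}$$ Here terms with $\hat f_\star(n,k)=0$ are understood to be $0$.
   Context: For a positive integer $M$, $[M]=\{1,\dots,M\}$. The falling factorial is $(m)_j=m(m-1)\cdots(m-j+1)$ ($j$ factors), with $(m)_0=1$. For $w_1,w_2>0$, $\mathcal{K}_{2N}(w_1,w_2)$ is the complete graph on $V=[2N]$ in which an edge $\{x,y\}$ has weight $w_1$ if $x,y\in[N]$ or $x,y\in[2N]\setminus[N]$ (same community), and weight $w_2$ otherwise. Let $G=(V,E,w)$ be a finite simple undirected connected weighted graph with edge weights $w:E\to[0,\infty)$. A spanning rooted forest $F$ of $G$ is a collection of vertex-disjoint rooted trees in $G$ whose vertex sets cover $V$; $|F|$ is its number of trees, $w(F)=\prod_{e\in F}w(e)$ is its weight (empty product equal to $1$), and $\Pi(F)$ is the partition of $V$ whose blocks are the vertex sets of the trees of $F$. For $q>0$, the loop-erased partition $\Pi_q$ is the random partition of $V$ with law $$\mathbb{P}(\Pi_q=\Pi)=\frac{1}{Z(q)}\sum_{F:\,\Pi(F)=\Pi}q^{|F|}w(F),\qquad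 Z(q)=\sum_{F}q^{|F|}w(F),$$ where sums are over spanning rooted forests of $G$ (the same tree with two different choices of root counts as two different rooted trees). For $x\in V$, $B_q(x)$ denotes the block of $\Pi_q$ containing $x$. The pairwise LEP-interaction potential is $U_q(x,y):=\mathbb{P}(B_q(x)\neq B_q(y))$ for distinct $x,y\in V$. The superscript $(N)$ indicates dependence on $N$. *)

(* Defs.v *)
From HB Require Import structures.
From mathcomp Require Import all_boot all_order all_algebra.
From mathcomp Require Import all_classical all_reals all_analysis.

Set Implicit Arguments.
Unset Strict Implicit.
Unset Printing Implicit Defensive.

Import Order.TTheory GRing.Theory Num.Theory.
Import numFieldNormedType.Exports.

Local Open Scope ring_scope.

(* Edges are unordered pairs of vertices, i.e. two-element sets; only the
   weights of the elements of [gedges] are meaningful. *)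
Record wgraph (R : realType) (V : finType) := WGraph {
  gedges : {set {set V}};
  gweight : {set V} -> R }.

Definition adj (V : finType) (D : {set {set V}}) : rel V :=
  fun x y => [set x; y]%SET \in D.

Definition is_wgraph (R : realType) (V : finType) (G : wgraph R V) : Prop :=
  [/\ forall e, e \in gedges G -> #|e| = 2%N,
      forall e, e \in gedges G -> 0 <= gweight G e
    & forall x y, connect (adj (gedges G)) x y].

(* A rooted tree is (vertex set, edge set, root). *)
Definition rtree (V : finType) : finType :=
  ({set V} * {set {set V}} * V)%type.

Definition tverts (V : finType) (t : rtree V) : {set V} := t.1.1.
Definition tedges (V : finType) (t : rtree V) : {set {set V}} := t.1.2.
Definition troot (V : finType) (t : rtree V) : V := t.2.

(* A two-vertex [x; y] is a [cycle] for the relation [adj] as soon as {x, y} is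
   an edge, so that genuine cycles are those with at least 3 vertices. *)
Definition acyclic (V : finType) (D : {set {set V}}) : Prop :=
  forall c : seq V, ucycle (adj D) c -> (size c <= 2)%N.

Definition is_rtree (R : realType) (V : finType) (G : wgraph R V)
    (t : rtree V) : Prop :=
  [/\ troot t \in tverts t,
      tedges t \subset gedges G,
      forall e, e \in tedges t -> e \subset tverts t,
      forall x y, x \in tverts t -> y \in tverts t -> connect (adj (tedges t)) x y
    & acyclic (tedges t)].

Definition is_forest (R : realType) (V : finType) (G : wgraph R V)
    (F : {set rtree V}) : Prop :=
  [/\ forall t, t \in F -> is_rtree G t,
      forall t t', t \in F -> t' \in F -> t != t' ->
        [disjoint tverts t & tverts t']
    & forall x : V, exists2 t, t \in F & x \in tverts t].

Definition forest_weight (R : realType) (V : finType) (G : wgraph R V)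
    (F : {set rtree V}) : R :=
  \prod_(t in F) \prod_(e in tedges t) gweight G e.

Definition forest_partition (V : finType) (F : {set rtree V}) : {set {set V}} :=
  [set tverts t | t in F]%SET.

Definition lep_Z (R : realType) (V : finType) (G : wgraph R V) (q : R) : R :=
  \sum_(F : {set rtree V} | `[< is_forest G F >])
    q ^+ #|F| * forest_weight G F.

Definition lep_law (R : realType) (V : finType) (G : wgraph R V) (q : R)
    (pi : {set {set V}}) : R :=
  (lep_Z G q)^-1 *
  \sum_(F : {set rtree V} | `[< is_forest G F >] && (forest_partition F == pi))
    q ^+ #|F| * forest_weight G F.

(* Measurability for maps into a finite set with its discrete sigma-algebra. *)
Definition finite_rv (d : measure_display) (Omega : measurableType d)
    (S : finType) (X : Omega -> S) : Prop :=
  forall s, measurable (X @^-1` [set s])%classic.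

(* [Pi] is a loop-erased partition; [lep_law] vanishes on the sets of sets that
   are not partitions of V. *)
Definition is_lep (d : measure_display) (Omega : measurableType d)
    (R : realType) (P : probability Omega R) (V : finType) (G : wgraph R V)
    (q : R) (Pi : Omega -> {set {set V}}) : Prop :=
  finite_rv Pi /\
  forall pi, P (Pi @^-1` [set pi])%classic = (lep_law G q pi)%:E.

Definition lep_potential (d : measure_display) (Omega : measurableType d)
    (R : realType) (P : probability Omega R) (V : finType)
    (Pi : Omega -> {set {set V}}) (x y : V) : R :=
  fine (P [set om | finset.pblock (Pi om) x != finset.pblock (Pi om) y]%classic).

Definition is_geometric (d : measure_display) (Omega : measurableType d)
    (R : realType) (P : probability Omega R) (T : {RV P >-> nat}) (xi : R) :=
  forall n : nat, (1 <= n)%N ->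
    P (T @^-1` [set n])%classic = (xi * (1 - xi) ^+ n.-1)%:E.

(* Homogeneous Markov chain on a finite state space started from [i0].  The
   Markov property is written without dividing by the probability of the
   past s_0, ..., s_m. *)
Definition is_markov_chain (d : measure_display) (Omega : measurableType d)
    (R : realType) (P : probability Omega R) (r : nat) (i0 : 'I_r)
    (A : 'M[R]_r) (X : nat -> Omega -> 'I_r) : Prop :=
  [/\ forall m, finite_rv (X m),
      P (X 0%N @^-1` [set i0])%classic = 1%E
    & forall (m : nat) (s : nat -> 'I_r),
        P [set om | forall j, (j <= m.+1)%N -> X j om = s j]%classic =
        (P [set om | forall j, (j <= m)%N -> X j om = s j]%classic *
         (A (s m) (s m.+1))%:E)%E].

Definition local_time (Omega : Type) (S : eqType) (X : nat -> Omega -> S)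
    (s : S) (n : nat) (om : Omega) : nat :=
  (\sum_(0 <= m < n) (X m om == s))%N.

(* Vertices are numbered from 0: [N] is {0, ..., N-1}. *)
Definition community1 (N : nat) : {set 'I_(2 * N)} :=
  [set x : 'I_(2 * N) | (x < N)%N]%SET.

Definition two_community_graph (R : realType) (N : nat) (w1 w2 : R) :
    wgraph R 'I_(2 * N) :=
  WGraph [set e : {set 'I_(2 * N)} | #|e| == 2%N]%SET
    (fun e => if (e \subset community1 N) || (e \subset ~: community1 N)
              then w1 else w2).

Lemma two_community_is_wgraph (R : realType) (N : nat) (w1 w2 : R) :
  0 < w1 -> 0 < w2 -> is_wgraph (two_community_graph N w1 w2).
Proof.
move=> w1_gt0 w2_gt0; split=> [e|e _|x y] /=.
- by rewrite inE => /eqP.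
- by case: ifP => _; exact: ltW.
- have [->|xy] := eqVneq x y; first exact: connect0.
  by apply: connect1; rewrite /adj inE cards2 xy.
Qed.

Inductive position := In | Out.

Definition position_of (N : nat) (y : 'I_(2 * N)) : position :=
  if y \in community1 N then In else Out.

Definition xi_q (R : realType) (q w1 w2 : R) (N : nat) : R := q / (q + N%:R * (w1 + w2)).

(* The state written \underline{1} is [ord0]. *)
Definition tilde_P (R : realType) (w1 w2 : R) : 'M[R]_2 :=
  let p := w1 / (w1 + w2) in
  \matrix_(i, j) (if i == j then p else 1 - p).

(* The truncated N - 2 is harmless: [In] only occurs for two distinct vertices
   in the same community, hence for N >= 2. *)
Definition f_hat (star : position) (N n k : nat) : nat :=
  match star with
  | Out => (N - 1) ^_ (k - 1) * (N - 1) ^_ (n - k)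
  | In => (N - 2) ^_ (k - 1) * N ^_ (n - k)
  end%N.

(* Subtractions involving N, n, k are in R; the radicand is nonnegative whenever
   f_hat is nonzero, since then k <= N and n - k <= N. *)
Definition lambda (R : realType) (w1 w2 : R) (N i n k : nat) : R :=
  - (1 / 2) *
  (w1 * n%:R + 2 * w2 * N%:R +
   (-1) ^+ i * Num.sqrt (w1 ^+ 2 * (2 * k%:R - n%:R) ^+ 2 +
     4 * (N%:R - k%:R) * (N%:R - n%:R + k%:R) * w2 ^+ 2)).

Definition theta (R : realType) (q w1 w2 : R) (N n k : nat) : R :=
  (q - lambda w1 w2 N 1 n k) * (q - lambda w1 w2 N 2 n k) /
  (q * (q + 2 * N%:R * w2)).

Definition k_star (R : realType) (star : position) (n k : nat) : R :=
  match star with Out => k%:R | In => n%:R - k%:R end.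

Definition P_dagger (R : realType) (star : position) (q w1 w2 : R)
    (N n k : nat) : R :=
  q * (q + k_star R star n k * (w1 - w2) + 2 * w2 * N%:R) /
  ((q + k%:R * w1) * (q + (n%:R - k%:R) * w1) +
   N%:R * w2 * (2 * q + n%:R * w1) +
   w2 ^+ 2 * (N%:R * n%:R - k%:R * (n%:R - k%:R))).

(* Main.v *)
Require Import Defs.
From HB Require Import structures.
From mathcomp Require Import all_boot all_order all_algebra.
From mathcomp Require Import all_classical all_reals all_analysis.
From mathcomp Require Import ring.

Set Implicit Arguments.
Unset Strict Implicit.
Unset Printing Implicit Defensive.

Import Order.TTheory GRing.Theory Num.Theory.
Import numFieldNormedType.Exports.

Local Open Scope ring_scope.

(* A rooted forest is encoded by its parent map f, a self-map of V whose fixpoints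
   are the roots, all orbits of f ending in a fixpoint.  Let the vertices of a set S
   be forced to be roots of weight 1.  Conditioning on the parent of one vertex y
   outside S turns sums over forests with forced roots S into sums over forests with
   forced roots y |: S, with explicit changes of the roots of the other vertices.

   In the two-community graph this recursion determines, by induction on the
   complement of S, closed forms for the mass of all forests, of those in which a
   given z has root s in S, and of those in which y has its root outside S: they only
   depend on the communities and on the number of vertices of S in each of them.
   Applied to the mass of the forests in which x and y have distinct roots outside S,
   the recursion adds x to S and moves x to one of its new neighbours; it unfolds into
   a sum over self-avoiding walks from x that avoid y (the loop-erased walk of Wilson's
   algorithm).  Counting these walks by community type gives the falling factorials
   of f_hat, and their weights are the path probabilities of the chain tilde_P. *)

(** * Parent maps *)

Section ParentMaps.
Variable V : finType.
Implicit Types (f g : {ffun V -> V}) (u v x y z r : V) (S : {set V}).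

(** An orbit has at most [#|V|] elements, so this many steps reach the fixpoint of the orbit if
    there is one; otherwise the value is meaningless, and [rooted] excludes that case. *)
Definition root_of f u : V := iter #|V| f u.

Definition rooted f : bool := [forall u, f (root_of f u) == root_of f u].

Definition redirect f y z : {ffun V -> V} :=
  [ffun u => if u == y then z else f u].

Lemma iter_fixed f r n : f r = r -> iter n f r = r.
Proof. by move=> fr; elim: n => //= n ->. Qed.

Lemma fconnect_root f u : fconnect f u (root_of f u).
Proof. exact: fconnect_iter. Qed.

Lemma root_ofP f u r : fconnect f u r -> f r = r -> root_of f u = r.
Proof.
move=> ur fr; have lt := leq_trans (findex_max ur) (max_card _).
by rewrite /root_of -(subnK (ltnW lt)) iterD iter_findex // iter_fixed.
Qed.

Lemma root_of_fixed f r : f r = r -> root_of f r = r.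
Proof. exact: root_ofP (connect0 _ _). Qed.

Lemma rootedP f u : rooted f -> f (root_of f u) = root_of f u.
Proof. by move/forallP/(_ u)/eqP. Qed.

Lemma root_of_connect f u v : rooted f -> fconnect f u v ->
  root_of f v = root_of f u.
Proof.
move=> rf uv; apply/esym/root_ofP; last exact: rootedP.
exact: connect_trans uv (fconnect_root _ _).
Qed.

Lemma root_of_step f u : rooted f -> root_of f (f u) = root_of f u.
Proof. by move=> rf; apply: root_of_connect => //; exact: fconnect1. Qed.

(** A return would put [u] on a cycle containing its root; as the root is fixed, the cycle would
    reduce to that root. *)
Lemma no_return f u : rooted f -> f u != u -> ~~ fconnect f (f u) u.
Proof.
move=> rf; apply: contraNN => fu_u; have := fconnect_f f u.
rewrite fu_u => /esym cyc.
have mem_r : root_of f u \in orbit f u by rewrite -fconnect_orbit fconnect_root.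
have ru : fconnect f (root_of f u) u.
  rewrite (fconnect_cycle cyc) //; exact: in_orbit.
by rewrite -(iter_findex ru) -iterS iterSr rootedP.
Qed.

(** The orbit of the parent loses [u]. The size of the orbit thus serves as depth in later
    inductions. *)
Lemma order_step f u : rooted f -> f u != u -> (order f (f u) < order f u)%N.
Proof.
move=> rf fu; apply/proper_card/fintype.properP; split.
  by apply/fintype.subsetP => w; apply: connect_trans; exact: fconnect1.
by exists u; [exact: connect0 | exact: no_return].
Qed.

Lemma rooted_measure (m : V -> nat) f :
  (forall u, f u != u -> (m (f u) < m u)%N) -> rooted f.
Proof.
move=> mf; apply/forallP => u; apply/eqP.
suff [r ur fr] : exists2 r, fconnect f u r & f r = r by rewrite (root_ofP ur fr).
have [n] := ubnP (m u); elim: n u => // n IH u /ltnSE le_n.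
have [fu|fu] := eqVneq (f u) u; first by exists u => //; exact: connect0.
have [r ur fr] := IH (f u) (leq_trans (mf u fu) le_n).
by exists r => //; exact: connect_trans (fconnect1 _ _) ur.
Qed.

Lemma fconnect_agree f g y u : (forall v, v != y -> f v = g v) ->
  fconnect g u y -> fconnect f u y.
Proof.
move=> fg /connectP[p]; elim: p u => [|v p IH] u /=.
  by move=> _ ->; exact: connect0.
case/andP => /eqP guv path_p last_p.
have [->|uy] := eqVneq u y; first exact: connect0.
apply: connect_trans (fconnect1 f u) _; rewrite (fg _ uy) guv; exact: IH.
Qed.

Lemma root_of_agree f g y u : (forall v, v != y -> f v = g v) ->
  ~~ fconnect g u y -> root_of f u = root_of g u.
Proof.
move=> fg guy; rewrite /root_of; elim: #|V| => //= n ->; apply: fg.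
by apply: contraNneq guy => <-; exact: fconnect_iter.
Qed.

Lemma redirect_other f y z v : v != y -> redirect f y z v = f v.
Proof. by rewrite ffunE => /negPf ->. Qed.

Lemma redirect_self f y z : redirect f y z y = z.
Proof. by rewrite ffunE eqxx. Qed.

(** Giving the root [y] a parent [z] outside its tree grafts the whole tree of [y] onto that of [z]
    and leaves all other roots unchanged. *)
Lemma root_of_redirect f y z u : f y = y -> rooted f ->
  (z == y) || (root_of f z != y) ->
  let r := if root_of f u == y then root_of f z else root_of f u in
  root_of (redirect f y z) u = r /\ redirect f y z r = r.
Proof.
move=> fy rf zy; set g := redirect f y z.
have gf v : v != y -> g v = f v by exact: redirect_other.
have nconn v : root_of f v != y -> ~~ fconnect f v y.
  by apply: contraNN => vy; apply/eqP/root_ofP.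
have off_y v : root_of f v != y ->
    root_of g v = root_of f v /\ g (root_of f v) = root_of f v.
  move=> vy; split; first exact: root_of_agree gf (nconn _ vy).
  by rewrite gf // rootedP.
case: ifP => [/eqP uy|/negbT]; last exact: off_y.
have gzfix : root_of g z = root_of f z /\ g (root_of f z) = root_of f z.
  have [zy'|] := eqVneq z y; last by move=> /negPf zy'; apply: off_y; rewrite zy' in zy.
  have gy : g y = y by rewrite redirect_self.
  by rewrite zy' (root_of_fixed gy) (root_of_fixed fy).
case: gzfix => gz gfz; split => //; apply: root_ofP => //.
have uy' : fconnect g u y.
  apply: (fconnect_agree gf); rewrite -uy; exact: fconnect_root.
apply: connect_trans uy' _; apply: connect_trans (fconnect1 g y) _.
by rewrite redirect_self -gz fconnect_root.
Qed.

(** The second condition rules out the only obstruction: a new parent [z], other than [y], in the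
    tree of [y] closes a cycle through [y]. *)
Lemma rooted_redirect f y z : f y = y ->
  rooted (redirect f y z) = rooted f && ((z == y) || (root_of f z != y)).
Proof.
move=> fy; apply/idP/andP => [rg|[rf zy]]; last first.
  by apply/forallP => u; have [-> ->] := root_of_redirect u fy rf zy.
set g := redirect f y z in rg.
have fg v : v != y -> f v = g v by move=> vy; rewrite redirect_other.
have rf : rooted f.
  apply: (@rooted_measure (order g)) => u fu.
  have uy : u != y by apply: contraNneq fu => ->; rewrite fy.
  by rewrite fg //; apply: order_step => //; rewrite -fg.
split=> //; have [//|zy /=] := eqVneq z y.
apply: contraTneq rg => zy'; apply/negP => rg.
have gy : g y = z by exact: redirect_self.
have := no_return (u := y) rg; rewrite gy => /(_ zy)/negP; apply.
apply: (fconnect_agree (f := g) (g := f)) => [v /fg -> //|].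
rewrite -zy'; exact: fconnect_root.
Qed.

Definition fixes S f : bool := [forall u in S, f u == u].

Lemma fixesP S f : reflect {in S, forall u, f u = u} (fixes S f).
Proof. exact: 'forall_in_eqP. Qed.

(** * Weighted sums over parent maps with forced roots *)

Section Weights.
Variable (R : comRingType) (a : V -> V -> R).

Definition pweight S f : R := \prod_(u in ~: S) a u (f u).

(** Maps are grouped by the parent [z] of [y]. Cutting the arc from [y] to [z] makes [y] a forced
    root, and [redirect f y z] restores the arc; the condition on [Q] is the effect of this grafting
    on the roots. *)
Lemma sum_redirect S y (Q : pred (V -> V)) :
    y \notin S ->
  \sum_(f | [&& rooted f, fixes S f & Q (root_of f)]) pweight S f =
  \sum_z a y z * \sum_(f | [&& rooted f, fixes (y |: S) f,
       (z == y) || (root_of f z != y) &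
       Q (fun u => if root_of f u == y then root_of f z else root_of f u)])
     pweight (y |: S) f.
Proof.
move=> yS; rewrite (partition_big (fun f => f y) xpredT) //=.
apply: eq_bigr => z _.
rewrite (reindex_onto (fun f => redirect f y z) (fun f => redirect f y y)); last first.
  move=> f /andP[_ /eqP fy]; apply/ffunP => u; rewrite !ffunE.
  by case: eqP => [->|].
rewrite mulr_sumr; apply: eq_big => [f|f /andP[/andP[/and3P[_ fS _] _] /eqP ff]].
  have [fy|fy] := eqVneq (f y) y; last first.
    rewrite [RHS](_ : _ = false); last first.
      apply/negP => /and4P[_ /fixesP fS _ _].
      by rewrite fS ?eqxx ?setU11 in fy.
    apply/negP => /andP[_ /eqP/ffunP/(_ y)]; rewrite redirect_self => fyy.
    by rewrite -fyy eqxx in fy.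
  have -> : redirect (redirect f y z) y y == f.
    apply/eqP/ffunP => u; rewrite !ffunE; case: eqP => [->|//]; by rewrite fy.
  have -> : fixes S (redirect f y z) = fixes (y |: S) f.
    apply/fixesP/fixesP => fS u.
      rewrite in_setU1 => /predU1P[-> //|uS]; rewrite -[RHS]fS // redirect_other //.
      by apply: contraNneq yS => <-.
    move=> uS; rewrite redirect_other; last by apply: contraNneq yS => <-.
    by apply: fS; rewrite in_setU1 uS orbT.
  rewrite redirect_self eqxx !andbT rooted_redirect //.
  case rf : (rooted f) => //=; case: (boolP (_ || _)) => zy /=; last by rewrite andbF.
  by congr (_ && Q _); apply/funext => u; have [-> _] := root_of_redirect u fy rf zy.
rewrite /pweight (bigD1 y) ?inE //= redirect_self; congr (_ * _).
apply: eq_big => u; first by rewrite !inE negb_or andbC.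
by case/andP => _ uy; rewrite redirect_other.
Qed.

Definition rooted_sum S (Q : pred (V -> V)) : R :=
  \sum_(f | [&& rooted f, fixes S f & Q (root_of f)]) pweight S f.

Lemma eq_rooted_sum S (Q Q' : pred (V -> V)) :
  (forall f, rooted f -> fixes S f -> Q (root_of f) = Q' (root_of f)) ->
  rooted_sum S Q = rooted_sum S Q'.
Proof.
move=> QQ'; apply: eq_bigl => f.
by case rf : (rooted f) => //=; case fS : (fixes S f) => //=; exact: QQ'.
Qed.

Lemma rooted_sum0 S : rooted_sum S pred0 = 0.
Proof. by apply: big_pred0 => f; rewrite /= !andbF. Qed.

Lemma rooted_sumC S (Q : pred (V -> V)) :
  rooted_sum S (predC Q) = rooted_sum S predT - rooted_sum S Q.
Proof.
apply/eqP; rewrite eq_sym subr_eq addrC /rooted_sum.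
rewrite (bigID (fun f : {ffun V -> V} => Q (root_of f))) /=; apply/eqP.
by congr (_ + _); apply: eq_bigl => f; rewrite andbT -andbA.
Qed.

(** The three terms are the possible parents of [y]: [y] itself, a forced root of [S], which is its
    own root so that no cycle can arise, or another free vertex, whose root must then differ from
    [y]. *)
Lemma rooted_sum_rec S y (Q : pred (V -> V)) : y \notin S ->
  rooted_sum S Q =
    a y y * rooted_sum (y |: S) Q +
    \sum_(z in S) a y z * rooted_sum (y |: S)
      (fun r : V -> V => Q (fun u => if r u == y then z else r u)) +
    \sum_(z in ~: (y |: S)) a y z * rooted_sum (y |: S)
      (fun r : V -> V => (r z != y) && Q (fun u => if r u == y then r z else r u)).
Proof.
move=> yS; rewrite [LHS](sum_redirect Q yS) (bigD1 y) //= -addrA; congr (_ + _).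
  congr (_ * _); apply: eq_bigl => f; rewrite eqxx /=.
  case: (rooted f) => //=; case: fixesP => //= fS.
  rewrite (root_of_fixed (fS y _)) ?setU11 //; congr Q; apply/funext => u.
  by case: eqP.
rewrite (bigID [in S]) /=; congr (_ + _).
  apply: eq_big => [z|z /andP[_ zS]].
    by case zS : (z \in S) => //=; rewrite ?andbF // andbT; apply: contraNneq yS => <-.
  have zy : z != y by apply: contraNneq yS => <-.
  congr (_ * _); apply: eq_bigl => f; rewrite (negPf zy) /=.
  case: (rooted f) => //=; case: fixesP => //= fS.
  by rewrite (root_of_fixed (fS z _)) ?inE ?zS ?orbT // zy.
apply: eq_big => [z|z /andP[/negPf zy _]]; first by rewrite !inE negb_or.
by rewrite zy.
Qed.

End Weights.
End ParentMaps.

(** * Rooted forests as parent maps *)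

Section ForestOfParentMap.
Variable V : finType.
Implicit Types (f g : {ffun V -> V}) (u v x y z r : V) (D : {set {set V}}).

Lemma set2_inj (x y u v : V) : u != v -> [set x; y]%SET = [set u; v]%SET ->
  x = u /\ y = v \/ x = v /\ y = u.
Proof.
move=> uv /setP e.
have /set2P ux : x \in [set u; v]%SET by rewrite -e set21.
have /set2P uy : y \in [set u; v]%SET by rewrite -e set22.
have /set2P xu : u \in [set x; y]%SET by rewrite e set21.
have /set2P xv : v \in [set x; y]%SET by rewrite e set22.
by move/eqP: uv; intuition congruence.
Qed.

Definition tree_of f r : rtree V :=
  ([set u | root_of f u == r]%SET,
   [set [set u; f u]%SET | u in [set u | (root_of f u == r) && (f u != u)]%SET]%SET,
   r).

Definition forest_of f : {set rtree V} :=
  [set tree_of f r | r in [set r | f r == r]%SET]%SET.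

Lemma adj_sym D : symmetric (adj D).
Proof. by move=> x y; rewrite /adj finset.setUC. Qed.

Lemma adj_tree_of f r x y : adj (tedges (tree_of f r)) x y ->
  x != y /\ (f x = y \/ f y = x).
Proof.
case/imsetP => u; rewrite inE => /andP[_ fu]; rewrite eq_sym in fu.
case/(set2_inj fu) => -[-> ->]; split; rewrite // 1?eq_sym //; by [left | right].
Qed.

Lemma tree_of_connect f r x y : rooted f -> root_of f x = r -> root_of f y = r ->
  connect (adj (tedges (tree_of f r))) x y.
Proof.
move=> rf xr yr.
have sym := sym_connect_sym (@adj_sym (tedges (tree_of f r))).
have to_root u : root_of f u = r -> connect (adj (tedges (tree_of f r))) u r.
  move=> ur; rewrite -[X in connect _ _ X]ur /root_of.
  elim: #|V| => [|n IH] /=; first exact: connect0.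
  apply: connect_trans IH _.
  have [->|fw] := eqVneq (f (iter n f u)) (iter n f u); first exact: connect0.
  apply: connect1; apply/imsetP; exists (iter n f u) => //.
  by rewrite inE fw andbT -ur (@root_of_connect _ _ u) // fconnect_iter.
by apply: connect_trans (to_root x xr) _; rewrite sym to_root.
Qed.

(* On a cycle of parent edges, both neighbours of a vertex of maximal depth are
   its parent. *)
Lemma parent_acyclic f D : rooted f ->
  (forall x y, adj D x y -> x != y /\ (f x = y \/ f y = x)) -> acyclic D.
Proof.
move=> rf Df c cyc; rewrite leqNgt; apply/negP => c3.
have [x0 x0c] : {x0 | x0 \in c}.
  by case: c c3 {cyc} => // x c _; exists x; rewrite mem_head.
pose u := [arg max_(i > x0 in c) order f i].
have [uc umax] : u \in c /\ forall v, v \in c -> (order f v <= order f u)%N.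
  by rewrite /u; case: arg_maxnP.
have to_parent v : v \in c -> adj D u v -> f u = v.
  move=> vc /Df[uv [//|fvu]].
  have : (order f u < order f v)%N by rewrite -{1}fvu order_step // fvu.
  by rewrite ltnNge umax.
case: (rot_to uc) => i p cp.
have : ucycle (adj D) (u :: p) by rewrite -cp rot_ucycle.
have sp : (2 <= size p)%N by rewrite -ltnS -[(size p).+1]/(size (u :: p)) -cp size_rot.
have mem_c v : v \in p -> v \in c by move=> vp; rewrite -(mem_rot i) cp inE vp orbT.
case: p sp mem_c {cp} => // v p; case: (lastP p) => // p' w _ mem_c.
case/andP => /=; rewrite !rcons_path last_rcons => /andP[uv /andP[_ wu]].
case/and3P => _ + _.
have -> : v = w.
  have wc : w \in c by apply: mem_c; rewrite inE mem_rcons inE eqxx orbT.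
  rewrite -(to_parent v) ?mem_c ?mem_head // (to_parent w) //.
  by rewrite adj_sym.
by rewrite mem_rcons mem_head.
Qed.

(** [d] is the distance to [r], with value 0 where [r] is unreachable; the second vertex of a
    shortest path is closer to [r]. This supplies the parents when a tree is turned into a parent
    map. *)
Lemma descent_to (e : rel V) r : exists d : V -> nat, forall u,
  connect e u r -> u != r -> exists2 v, e u v & (d v < d u)%N.
Proof.
pose reach u n := [exists p : n.-tuple V, path e u p && (last u p == r)].
have reachP u : connect e u r -> exists n, reach u n.
  case/connectP => p pth lst; exists (size p); apply/existsP; exists (in_tuple p).
  by rewrite /= pth -lst eqxx.
exists (fun u => if pselect (exists n, reach u n) is left ex then ex_minn ex else 0%N).
move=> u /reachP exu ur; case: pselect => // {}exu.
case: ex_minnP => n /existsP[p /andP[pth lst]] min_n.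
case: p pth lst => -[|v p] /= /eqP sz; first by rewrite (negPf ur).
move=> /andP[uv pth] lst; exists v => //.
have rv : reach v (size p).
  by apply/existsP; exists (in_tuple p); rewrite /= pth.
case: pselect => [exv|]; last by case; exists (size p).
by case: ex_minnP => m _ /(_ _ rv) le_m; rewrite -sz ltnS.
Qed.

(** * Weight-preserving bijection between rooted parent maps and spanning rooted forests *)

Section Graph.
Variables (R : realType) (G : wgraph R V).

Definition spanning f : bool :=
  rooted f && [forall u, (f u != u) ==> ([set u; f u]%SET \in gedges G)].

Lemma is_forest_of f : spanning f -> is_forest G (forest_of f).
Proof.
case/andP => rf /forallP fG; split=> [t /imsetP[r]|t t' /imsetP[r _ ->] /imsetP[s _ ->] rs|x].
- rewrite inE => /eqP fr ->; split=> /=.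
  + by rewrite inE root_of_fixed.
  + apply/fintype.subsetP => e /imsetP[u]; rewrite inE => /andP[_ fu] ->.
    by have := fG u; rewrite fu.
  + move=> e /imsetP[u]; rewrite inE => /andP[/eqP ur _] ->.
    by apply/fintype.subsetP => v; rewrite !inE => /orP[] /eqP ->;
       rewrite ?root_of_step // ur.
  + by move=> x y; rewrite !inE => /eqP xr /eqP yr; exact: tree_of_connect.
  + by apply: (parent_acyclic rf) => x y; exact: adj_tree_of.
- apply/pred0P => u /=; rewrite !inE; apply/negP => /andP[/eqP ur /eqP us].
  by move: rs; rewrite -ur -us eqxx.
- exists (tree_of f (root_of f x)); last by rewrite inE.
  by apply/imsetP; exists (root_of f x); rewrite // inE rootedP.
Qed.

Lemma forest_of_roots f g r : forest_of f = forest_of g -> f r = r -> g r = r.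
Proof.
move=> fg fr.
have : tree_of f r \in forest_of f by apply/imsetP; exists r; rewrite // inE fr.
by rewrite fg => /imsetP[s]; rewrite inE => /eqP gs [_ _ ->].
Qed.

Lemma forest_of_edges f g u : rooted f -> forest_of f = forest_of g -> f u != u ->
  g u = f u \/ g (f u) = u.
Proof.
move=> rf fg fu.
have : tree_of f (root_of f u) \in forest_of f.
  by apply/imsetP; exists (root_of f u); rewrite // inE rootedP.
rewrite fg => /imsetP[s _ [_ /setP/(_ [set u; f u]%SET) + _]].
have -> : [set u; f u]%SET \in
    [set [set v; f v]%SET | v in [set v | (root_of f v == root_of f u) && (f v != v)]%SET]%SET.
  by apply/imsetP; exists u; rewrite // inE eqxx.
move/esym/imsetP => [v]; rewrite inE => /andP[_ gv]; rewrite eq_sym in gv.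
by case/(set2_inj gv) => -[-> ->]; [left | right].
Qed.

(** Induction on depth. The edge from [u] to [f u] can only be reversed in [g] if [g (f u) = u]; the
    maps agree at [f u] by induction, so [f] would return to [u]. *)
Lemma forest_of_inj f g : rooted f -> rooted g -> forest_of f = forest_of g -> f = g.
Proof.
move=> rf rg fg; apply/ffunP => u.
have [n] := ubnP (order f u); elim: n u => // n IH u /ltnSE le_n.
have [fu|fu] := eqVneq (f u) u; first by rewrite fu (forest_of_roots fg).
have ffu : f (f u) = g (f u) by apply: IH; exact: leq_trans (order_step rf fu) _.
case: (forest_of_edges rf fg fu) => [//|gfu].
have /negP[] := no_return rf fu; rewrite -{2}gfu -ffu; exact: fconnect1.
Qed.

Lemma forest_of_surj (F : {set rtree V}) : is_wgraph G -> is_forest G F ->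
  exists2 f, spanning f & forest_of f = F.
Proof.
case=> G2 _ _ [treeF disjF covF].
have /choice[tr trP] : forall u, exists t : rtree V, t \in F /\ u \in tverts t.
  by move=> u; have [t tF ut] := covF u; exists t.
have trE t u : t \in F -> u \in tverts t -> tr u = t.
  move=> tF ut; have [tuF utu] := trP u; apply/eqP; apply: contraTT utu => ne.
  apply/negP => utu; have /pred0P/(_ u) := disjF _ _ tuF tF ne.
  by rewrite /= utu ut.
have /choice[d dP] : forall t : rtree V, exists d : V -> nat, forall u,
    connect (adj (tedges t)) u (troot t) -> u != troot t ->
    exists2 v, adj (tedges t) u v & (d v < d u)%N.
  by move=> t; exact: descent_to.
(* The parent of a non-root is a neighbour in its own tree that is strictly closer to the root. *)
have /choice[p pP] : forall u, exists v, if u == troot (tr u) then v = u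
    else adj (tedges (tr u)) u v /\ (d (tr u) v < d (tr u) u)%N.
  move=> u; case: eqP => [_|/eqP ur]; first by exists u.
  have [tuF utu] := trP u; have [rt _ _ cn _] := treeF _ tuF.
  by have [v uv lt_v] := dP _ _ (cn _ _ utu rt) ur; exists v.
have tr_p u : tr (p u) = tr u.
  have := pP u; case: ifP => [_ -> //|_ [up _]].
  have [tuF utu] := trP u; have [_ _ sub _ _] := treeF _ tuF.
  by apply: trE => //; apply: (fintype.subsetP (sub _ up)); rewrite !inE eqxx orbT.
pose f : {ffun V -> V} := [ffun u => p u].
have fE u : f u = p u by rewrite ffunE.
have fixE u : (f u == u) = (u == troot (tr u)).
  have := pP u; rewrite fE; case: ifP => [_ ->|_ [_ lt]]; first by rewrite eqxx.
  by apply/negP => /eqP pu; rewrite pu ltnn in lt.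
have rf : rooted f.
  apply: (@rooted_measure _ (fun u => d (tr u) u)) => u.
  by rewrite fixE fE tr_p; have := pP u; case: ifP => // _ [].
have tr_root u : tr (root_of f u) = tr u.
  by rewrite /root_of; elim: #|V| => //= n IH; rewrite fE tr_p.
have rootE u : root_of f u = troot (tr u).
  by rewrite -tr_root; apply/eqP; rewrite -fixE rootedP.
have troot_in t : t \in F -> tr (troot t) = t.
  by move=> tF; apply: trE => //; have [] := treeF _ tF.
have vertsE t : t \in F -> [set u | root_of f u == troot t]%SET = tverts t.
  move=> tF; apply/setP => u; rewrite inE rootE.
  have [tuF utu] := trP u.
  apply/eqP/idP => [eq_r|ut]; last by rewrite (trE t).
  by rewrite -(troot_in t tF) -eq_r troot_in.
have parent_edge u : f u != u -> [set u; f u]%SET \in tedges (tr u).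
  by rewrite fixE fE; have := pP u; case: ifP => // _ [].
exists f.
  rewrite /spanning rf; apply/forallP => u; apply/implyP => fu.
  have [tuF _] := trP u; have [_ sub _ _ _] := treeF _ tuF.
  by apply: (fintype.subsetP sub); exact: parent_edge.
have treeE t : t \in F -> tree_of f (troot t) = t.
  move=> tF; have [rt subG subV cn acy] := treeF _ tF.
  suff edgesE : tedges (tree_of f (troot t)) = tedges t.
    rewrite [LHS]surjective_pairing [X in (X, _)]surjective_pairing.
    rewrite -/(tedges _) edgesE /= vertsE //.
    by rewrite /tverts /tedges /troot -!surjective_pairing.
  have sub : tedges (tree_of f (troot t)) \subset tedges t.
    apply/fintype.subsetP => e /imsetP[u]; rewrite inE => /andP[ur fu] ->.
    suff <- : tr u = t by exact: parent_edge.
    by apply: trE => //; rewrite -vertsE // inE.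
  apply/eqP; rewrite finset.eqEsubset sub; apply/fintype.subsetP => e et.
  have /cards2P[u [v [uv eE]]] : #|e| == 2%N by rewrite G2 // (fintype.subsetP subG).
  rewrite eE in et *; apply/negPn/negP => nuv.
  have mem w : w \in [set u; v]%SET -> root_of f w = troot t.
    by move=> wuv; apply/eqP; have := fintype.subsetP (subV _ et) w wuv; rewrite -vertsE // inE.
  (* A tree edge that is not a parent edge, together with the simple path of parent edges joining
     its ends, would close a cycle of at least three vertices. *)
  have := tree_of_connect rf (mem u (set21 _ _)) (mem v (set22 _ _)).
  case/connectP => s0 pth0 lst0; case/shortenP: pth0 lst0 => s pth us _ lst.
  have s2 : (2 <= size s)%N.
    case: s pth us lst => [|w [|//]] /=; first by move=> _ _ vu; rewrite vu eqxx in uv.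
    by rewrite andbT => uw _ vw; move: nuv; rewrite vw -/(adj _ u w) uw.
  have /acy : ucycle (adj (tedges t)) (u :: s).
    apply/andP; split => //=; rewrite rcons_path -lst adj_sym {2}/adj et andbT.
    by apply: sub_path pth => a b; exact: (fintype.subsetP sub).
  by rewrite /= leqNgt ltnS s2.
apply/setP => t; apply/imsetP/idP => [[r]|tF].
  by rewrite inE fixE => /eqP rE ->; rewrite rE treeE; have [] := trP r.
exists (troot t); last by rewrite treeE.
by rewrite inE fixE troot_in.
Qed.

Variable q : R.

(** A root counts as a loop of weight [q], so that the factor for the number of trees and the edge
    weights form a single product over vertices. *)
Definition arc_weight u z : R := if z == u then q else gweight G [set u; z]%SET.

Lemma forest_of_weight f : rooted f ->
  q ^+ #|forest_of f| * forest_weight G (forest_of f) = pweight arc_weight finset.set0 f.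
Proof.
move=> rf; have tree_inj : injective (tree_of f) by move=> r s [].
rewrite card_imset // /forest_weight big_imset /=; last by move=> ? ? _ _; exact: tree_inj.
rewrite /pweight [RHS](bigID (fun u => f u == u)) /=; congr (_ * _).
  rewrite -prodr_const; apply: eq_big => u; first by rewrite !inE.
  by rewrite inE => /eqP fu; rewrite /arc_weight fu eqxx.
rewrite [RHS](partition_big (root_of f) [in [set r | f r == r]%SET]) /=; last first.
  by move=> u _; rewrite inE rootedP.
apply: eq_bigr => r _; rewrite big_imset /=; last first.
  (* Distinct vertices have distinct parent edges: otherwise they would be each other's parent,
     against [no_return]. *)
  move=> u v; rewrite !inE => /andP[_ fu] /andP[_ fv]; rewrite eq_sym in fv.
  case/(set2_inj fv) => -[] // uE fuE; have /negP[] := no_return rf fu.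
  by have := fconnect1 f (f u); rewrite {2}fuE -uE.
apply: eq_big => u; first by rewrite !inE andbC.
by rewrite inE /arc_weight => /andP[_ /negPf ->].
Qed.

Lemma forest_of_pblock f x y : rooted f ->
  (finset.pblock (forest_partition (forest_of f)) x ==
   finset.pblock (forest_partition (forest_of f)) y) = (root_of f x == root_of f y).
Proof.
move=> rf; set P := forest_partition _.
have triv : finset.trivIset P.
  apply/finset.trivIsetP => A B /imsetP[t /imsetP[r _ ->] ->] /imsetP[t' /imsetP[s _ ->] ->].
  move=> rs; apply/pred0P => u /=; rewrite !inE; apply/negP => /andP[/eqP ur /eqP us].
  by move: rs; rewrite -ur -us eqxx.
have pbE u : finset.pblock P u = [set v | root_of f v == root_of f u]%SET.
  apply: def_pblock => //; last by rewrite inE.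
  apply/imsetP; exists (tree_of f (root_of f u)) => //.
  by apply/imsetP; exists (root_of f u); rewrite // inE rootedP.
rewrite !pbE; apply/eqP/eqP => [/setP/(_ x)|-> //]; rewrite !inE eqxx.
by move/esym/eqP.
Qed.

Lemma sum_forests (Q : pred {set rtree V}) : is_wgraph G ->
  \sum_(F : {set rtree V} | `[< is_forest G F >] && Q F)
     q ^+ #|F| * forest_weight G F =
  \sum_(f | spanning f && Q (forest_of f)) pweight arc_weight finset.set0 f.
Proof.
move=> wG; pose A := [set f | spanning f && Q (forest_of f)]%SET.
rewrite (eq_bigl [in forest_of @: A]) => [|F]; last first.
  apply/andP/imsetP => [[/asboolP/(forest_of_surj wG)[f sf <-] Qf]|[f]].
    by exists f; rewrite // inE sf.
  by rewrite inE => /andP[sf Qf] ->; split=> //; apply/asboolP; exact: is_forest_of.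
rewrite big_imset /=; last first.
  move=> f g; rewrite !inE => /andP[/andP[rf _] _] /andP[/andP[rg _] _].
  exact: forest_of_inj.
apply: eq_big => f; first by rewrite inE.
by rewrite inE => /andP[/andP[rf _] _]; exact: forest_of_weight.
Qed.

End Graph.
End ForestOfParentMap.

(** * Forest masses in a two-community graph *)

Section TwoCommunities.
Variables (R : numFieldType) (V : finType) (comm : V -> bool) (N : nat).
Variables (q w1 w2 : R).
Hypotheses (q_gt0 : 0 < q) (w1_gt0 : 0 < w1) (w2_gt0 : 0 < w2).
Hypothesis card_comm : forall c, #|[set u | comm u == c]%SET| = N.
Implicit Types (f : {ffun V -> V}) (u x y z s : V) (S : {set V}) (c : bool).

Definition type_weight c c' : R := if c == c' then w1 else w2.

Definition arc u z : R := if z == u then q else type_weight (comm u) (comm z).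

(** This is the total weight of all arcs out of a vertex, plus [w1] for a fictitious arc to itself
    within its community. *)
Definition total_rate : R := q + N%:R * (w1 + w2).
Local Notation M := total_rate.

Definition cnt S c : nat := #|[set u in S | comm u == c]%SET|.
Local Notation k S c := (cnt S c)%:R.

Lemma total_rate_neq0 : M != 0.
Proof. by rewrite gt_eqF // ltr_pwDl // mulr_ge0 // addr_ge0 // ltW. Qed.

Lemma cnt_setU1 S y c : y \notin S -> cnt (y |: S) c = ((comm y == c) + cnt S c)%N.
Proof.
move=> yS; rewrite /cnt; case: (eqVneq (comm y) c) => yc; last first.
  rewrite add0n; congr #|pred_of_set _|; apply/setP => u; rewrite !inE.
  by case: eqP => //= ->; rewrite (negPf yc) andbF.
have -> : [set u in y |: S | comm u == c]%SET = y |: [set u in S | comm u == c]%SET.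
  by apply/setP => u; rewrite !inE; case: eqP => //= ->; rewrite yc eqxx.
by rewrite cardsU1 inE (negPf yS).
Qed.

Lemma cnt_set0 c : cnt finset.set0 c = 0%N.
Proof. by apply: eq_card0 => u; rewrite !inE. Qed.

Lemma cnt_setT c : cnt [set: V] c = N.
Proof. by rewrite -(card_comm c); apply: eq_card => u; rewrite !inE. Qed.

Lemma cntC S c : (cnt S c + cnt (~: S) c)%N = N.
Proof.
rewrite -(card_comm c) -(cardsID S [set u | comm u == c]%SET).
by congr (_ + _)%N; apply: eq_card => z; rewrite !inE // andbC.
Qed.

Lemma cnt_setC S c : (cnt (~: S) c)%:R = N%:R - k S c :> R.
Proof. by rewrite -(cntC S c) natrD addrAC subrr add0r. Qed.

Lemma sum_outside S (phi : bool -> R) :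
  \sum_(z in ~: S) phi (comm z) =
  (N%:R - k S true) * phi true + (N%:R - k S false) * phi false.
Proof.
have count c : \sum_(z in ~: S | comm z == c) phi (comm z) = (N%:R - k S c) * phi c.
  rewrite (eq_bigr (fun=> phi c)); last by move=> z /andP[_ /eqP ->].
  rewrite sumr_const -[LHS]mulr_natl -cnt_setC; congr (_%:R * _).
  by apply: eq_card => z; rewrite [LHS]unfold_in !inE.
rewrite (bigID comm) /= -!count; congr (_ + _); apply: eq_bigl => z.
  by rewrite eqb_id.
by case: (comm z).
Qed.

(** Determinant of q plus the Laplacian restricted to the complement of [S], acting on functions
    constant on communities. The other eigenvalues equal [M], so by the matrix-tree theorem the
    forest mass is this determinant times a power of [M]. *)
Definition spanning_mass S : R :=
  (q + k S true * w1 + N%:R * w2) * (q + k S false * w1 + N%:R * w2) -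
  w2 ^+ 2 * (N%:R - k S true) * (N%:R - k S false).

(** This and [hit_mass] are the numerators given by Cramer's rule for the same 2 by 2 system, with
    right-hand side q, respectively the weights of the arcs into a fixed vertex of [S] of community
    [c]. *)
Definition escape_mass S c : R := q * (q + 2 * N%:R * w2 + k S (~~ c) * (w1 - w2)).

Definition hit_mass S c c' : R :=
  if c == c' then w1 * (q + k S (~~ c) * w1 + N%:R * w2) + w2 ^+ 2 * (N%:R - k S (~~ c))
  else w2 * M.

(** * Recursions on the set of forced roots *)

Lemma hit_rec S s z : z \notin S -> s \in S ->
  rooted_sum arc S (fun r => r z == s) =
  arc z s * rooted_sum arc (z |: S) predT +
  \sum_(z' in ~: (z |: S)) arc z z' * rooted_sum arc (z |: S) (fun r => r z' == s).
Proof.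
move=> zS sS; rewrite (rooted_sum_rec _ _ zS).
have sz : s != z by apply: contraNneq zS => <-.
rewrite (_ : rooted_sum arc (z |: S) _ = 0) ?mulr0 ?add0r; last first.
  rewrite -(rooted_sum0 arc (z |: S)); apply: eq_rooted_sum => f rf /fixesP fS.
  by rewrite root_of_fixed ?fS ?setU11 // eq_sym (negPf sz).
have root_z f : fixes (z |: S) f -> root_of f z = z.
  by move=> /fixesP fS; rewrite root_of_fixed ?fS ?setU11.
congr (_ + _).
  rewrite (bigD1 s) //= big1 ?addr0.
    by congr (_ * _); apply: eq_rooted_sum => f _ /root_z ->; rewrite !eqxx.
  move=> t /andP[_ /negPf ts]; rewrite -[RHS](mulr0 (arc z t)); congr (_ * _).
  rewrite -(rooted_sum0 arc (z |: S)).
  by apply: eq_rooted_sum => f _ /root_z ->; rewrite eqxx.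
apply: eq_bigr => t _; congr (_ * _); apply: eq_rooted_sum => f _ /root_z ->.
by rewrite eqxx; case: eqP => // ->; rewrite eq_sym (negPf sz).
Qed.

Lemma escape_rec S y : y \notin S ->
  rooted_sum arc S (fun r => r y \notin S) =
  q * rooted_sum arc (y |: S) predT +
  \sum_(z in ~: (y |: S))
    arc y z * rooted_sum arc (y |: S) (fun r => r z \notin y |: S).
Proof.
move=> yS; rewrite (rooted_sum_rec _ _ yS) /arc eqxx.
have root_y f : fixes (y |: S) f -> root_of f y = y.
  by move=> /fixesP fS; rewrite root_of_fixed ?fS ?setU11.
rewrite -[RHS]addr0 [RHS]addrAC; congr (_ * _ + _ + _).
- by apply: eq_rooted_sum => f _ /root_y ->.
- apply: big1 => t tS; rewrite -[RHS](mulr0 (arc y t)); congr (_ * _).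
  rewrite -(rooted_sum0 arc (y |: S)).
  by apply: eq_rooted_sum => f _ /root_y ->; rewrite eqxx tS.
- apply: eq_bigr => t _; congr (_ * _); apply: eq_rooted_sum => f _ /root_y ->.
  by rewrite eqxx in_setU1 negb_or.
Qed.

(** If the parent of [x] is [z], then [x] takes the root of [z], which must avoid [x] and [S]. The
    root of [y] cannot be [x] either, since [y] would then be carried to the same root as [x]. *)
Lemma separate_rec S x y : x \notin S -> y \notin S -> x != y ->
  rooted_sum arc S (fun r => [&& r x \notin S, r y \notin S & r x != r y]) =
  q * rooted_sum arc (x |: S) (fun r => r y \notin x |: S) +
  \sum_(z in ~: (x |: S)) arc x z * rooted_sum arc (x |: S)
    (fun r => [&& r z \notin x |: S, r y \notin x |: S & r z != r y]).
Proof.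
move=> xS yS xy; rewrite (rooted_sum_rec _ _ xS) /arc eqxx.
have root_x f : fixes (x |: S) f -> root_of f x = x.
  by move=> /fixesP fS; rewrite root_of_fixed ?fS ?setU11.
rewrite -[RHS]addr0 [RHS]addrAC; congr (_ * _ + _ + _).
- apply: eq_rooted_sum => f _ /root_x ->.
  by rewrite xS in_setU1 negb_or [x == _]eq_sym [RHS]andbC.
- apply: big1 => t tS; rewrite -[RHS](mulr0 (arc x t)); congr (_ * _).
  rewrite -(rooted_sum0 arc (x |: S)).
  by apply: eq_rooted_sum => f _ /root_x ->; rewrite eqxx tS.
- apply: eq_bigr => t _; congr (_ * _); apply: eq_rooted_sum => f _ /root_x ->.
  rewrite eqxx !in_setU1 !negb_or -!andbA; congr (_ && (_ && _)).
  by case: (eqVneq (root_of f y) x) => //=; rewrite eqxx !andbF.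
Qed.

Lemma spanning_rec S y : y \notin S ->
  rooted_sum arc S predT =
  (M - w1) * rooted_sum arc (y |: S) predT -
  \sum_(z in ~: (y |: S)) arc y z * rooted_sum arc (y |: S) (fun r => r z == y).
Proof.
move=> yS; rewrite (rooted_sum_rec _ _ yS).
rewrite [X in _ + _ + X](eq_bigr (fun z => arc y z * rooted_sum arc (y |: S) predT -
    arc y z * rooted_sum arc (y |: S) (fun r => r z == y))); last first.
  move=> z _; rewrite -mulrBr -rooted_sumC; congr (_ * _).
  by apply: eq_rooted_sum => f _ _; rewrite /= andbT.
rewrite big_split /= sumrN addrA -!mulr_suml -!mulrDl; congr (_ * _ - _); rewrite -addrA.
have -> : \sum_(z in S) arc y z + \sum_(z in ~: (y |: S)) arc y z =
    \sum_(z in ~: [set y]) type_weight (comm y) (comm z).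
  rewrite [RHS](bigID [in S]) /=; congr (_ + _); apply: eq_big => z.
  - rewrite !inE; case zS : (z \in S); rewrite ?andbF // andbT.
    by apply/esym; apply: contraNneq yS => <-.
  - by move=> zS; rewrite /arc; case: eqP => // zy; rewrite -zy zS in yS.
  - by rewrite !inE negb_or.
  - by rewrite !inE negb_or /arc => /andP[/negPf ->].
rewrite (sum_outside _ (type_weight (comm y))) -(finset.setU0 [set y]%SET).
rewrite !cnt_setU1 ?inE // !cnt_set0 /arc eqxx /total_rate.
by case: (comm y); rewrite /type_weight /=; ring.
Qed.

(** The three formulas are proved jointly, because the recursion for each one uses the others on
    [y |: S]. After removing a common power of [M], every case is a polynomial identity in the
    counts. *)
Lemma forest_masses S :
  [/\ rooted_sum arc S predT = M ^+ #|~: S| / M ^+ 2 * spanning_mass S,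
      forall y, y \notin S -> rooted_sum arc S (fun r => r y \notin S) =
        M ^+ #|~: S| / M ^+ 2 * escape_mass S (comm y)
    & forall s z, s \in S -> z \notin S -> rooted_sum arc S (fun r => r z == s) =
        M ^+ #|~: S| / M ^+ 2 * hit_mass S (comm s) (comm z)].
Proof.
have [n] := ubnP #|~: S|; elim: n S => // n IH S /ltnSE le_n.
have M0 := total_rate_neq0.
(* As [y] lies in [T], no arc of the sum is a loop, and each weight depends only on communities. *)
have split_arc y (T : {set V}) (phi : bool -> R) : y \in T ->
    \sum_(z in ~: T) arc y z * phi (comm z) =
    (N%:R - k T true) * (type_weight (comm y) true * phi true) +
    (N%:R - k T false) * (type_weight (comm y) false * phi false).
  move=> yT; rewrite -(sum_outside T (fun c => type_weight (comm y) c * phi c)).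
  apply: eq_bigr => z; rewrite inE => zT; rewrite /arc; case: eqP => // zy.
  by rewrite zy yT in zT.
have outside (T : {set V}) z : z \in ~: T -> z \notin T by rewrite inE.
have cardC y : y \notin S -> #|~: S| = #|~: (y |: S)|.+1.
  move=> yS; rewrite (cardsD1 y) inE yS add1n; congr #|pred_of_set _|.+1.
  by apply/setP => u; rewrite !inE negb_or.
have {}IH y (yS : y \notin S) := IH (y |: S) (leq_trans (eq_leq (esym (cardC y yS))) le_n).
split.
- case: (pickP [pred y | y \notin S]) => [y /= yS|S_full].
    have [IHF IHE IHJ] := IH y yS.
    rewrite (spanning_rec yS) IHF (cardC y yS).
    rewrite (eq_bigr _ (fun z zT => congr1 (GRing.mul (arc y z))
      (IHJ _ _ (setU11 _ _) (outside _ _ zT)))).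
    rewrite (split_arc y _ (fun c => _ * hit_mass _ _ c)) ?setU11 //.
    rewrite (exprS M #|_|) -[M * _ / _]mulrA; set C := _ / _.
    rewrite /spanning_mass /hit_mass /type_weight /total_rate !cnt_setU1 // !natrD.
    by case: (comm y) => /=; ring.
  have -> : S = [set: V]%SET.
    by apply/setP => y; have := S_full y; rewrite /= inE => /negbFE ->.
  (* When every vertex is a forced root, only the identity map remains, with weight 1. *)
  pose i : {ffun V -> V} := [ffun u => u].
  rewrite /rooted_sum (big_pred1 i) => [|f]; last first.
    rewrite andbT; apply/andP/eqP => [[_ /fixesP fT]|->].
      by apply/ffunP => u; rewrite fT ?inE // ffunE.
    by split; [apply/forallP => u | apply/fixesP => u _]; rewrite ffunE.
  rewrite /pweight finset.setCT big_set0 cards0 /spanning_mass !cnt_setT.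
  rewrite !subrr mulr0 subr0 [X in _ * X](_ : _ = M ^+ 2); last first.
    by rewrite /total_rate; ring.
  by rewrite expr0 mul1r mulVf // expf_neq0.
- move=> y yS; have [IHF IHE IHJ] := IH y yS.
  rewrite (escape_rec yS) IHF (cardC y yS).
  rewrite (eq_bigr _ (fun z zT => congr1 (GRing.mul (arc y z)) (IHE _ (outside _ _ zT)))).
  rewrite (split_arc y _ (fun c => _ * escape_mass _ c)) ?setU11 //.
  rewrite (exprS M #|_|) -[M * _ / _]mulrA; set C := _ / _.
  rewrite /spanning_mass /escape_mass /type_weight /total_rate !cnt_setU1 // !natrD.
  by case: (comm y) => /=; ring.
- move=> s z sS zS; have [IHF IHE IHJ] := IH z zS.
  rewrite (hit_rec zS sS) IHF (cardC z zS).
  rewrite (eq_bigr _ (fun u uT => congr1 (GRing.mul (arc z u))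
      (IHJ _ _ (setU1r _ sS) (outside _ _ uT)))).
  rewrite (split_arc z _ (fun c => _ * hit_mass _ _ c)) ?setU11 //.
  rewrite (exprS M #|_|) -[M * _ / _]mulrA; set C := _ / _.
  rewrite /arc (_ : s == z = false); last by apply/negbTE; apply: contraNneq zS => <-.
  rewrite /spanning_mass /hit_mass /type_weight /total_rate !cnt_setU1 // !natrD.
  by case: (comm s); case: (comm z) => /=; ring.
Qed.

(* Total weight of the n-step sequences of communities that start in c and have
   a of their n later terms equal to true. *)
Fixpoint walk_weight n a c : R :=
  if n is n'.+1 then
    type_weight c true * (if a is a'.+1 then walk_weight n' a' true else 0) +
    type_weight c false * walk_weight n' a false
  else (a == 0)%:R.

Lemma walk_weight_gt n a c : (n < a)%N -> walk_weight n a c = 0.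
Proof.
elim: n a c => [|n IH] [|a] c //= lt_na.
by rewrite !IH ?mulr0 ?addr0 // ltnW.
Qed.

(** Weighted count of self-avoiding walks with fewer than [L] steps, by community type: the falling
    factorials choose the successive distinct vertices from pools of sizes [A1] and [A2]. *)
Definition walk_sum L c (A1 A2 : nat) (g : nat -> nat -> R) : R :=
  \sum_(n < L) \sum_(a < n.+1)
    walk_weight n a c * (A1 ^_ a)%:R * (A2 ^_ (n - a))%:R * g n a.

(** First-step decomposition: either the walk stops at once, or its first step uses up one vertex of
    the pool it enters. *)
Lemma walk_sumS L c A1 A2 g : walk_sum L.+1 c A1 A2 g =
  g 0 0 +
  (A1%:R * (type_weight c true *
     walk_sum L true A1.-1 A2 (fun n a => g n.+1 a.+1)) +
   A2%:R * (type_weight c false *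
     walk_sum L false A1 A2.-1 (fun n a => g n.+1 a))).
Proof.
rewrite /walk_sum big_ord_recl big_ord1 /= subnn !ffactn0 !mul1r; congr (_ + _).
rewrite !mulr_sumr -big_split; apply: eq_bigr => n _ /=.
rewrite !mulr_sumr [in RHS]/= /bump leq0n add1n.
under eq_bigr do rewrite -mulrA mulrDl mulrDl.
rewrite big_split /= big_ord_recl /= !(mulr0, mul0r) add0r; congr (_ + _).
  apply: eq_bigr => a _; rewrite /bump leq0n add1n subSS ffactnS natrM; ring.
rewrite big_ord_recr /= walk_weight_gt // !(mulr0, mul0r) addr0.
apply: eq_bigr => a _; rewrite subSn -1?ltnS ?ltn_ord // ffactnS natrM; ring.
Qed.

Lemma eq_walk_sum L c A1 A2 g g' :
  (forall n a, (a <= n)%N -> g n a = g' n a) ->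
  walk_sum L c A1 A2 g = walk_sum L c A1 A2 g'.
Proof.
by move=> gg'; apply: eq_bigr => n _; apply: eq_bigr => a _; rewrite gg' -1?ltnS ?ltn_ord.
Qed.

(** Contribution of a walk that stops after [n] steps, [a] of them into [true]: a factor [q] for
    making its last vertex a root, times the escape mass of [y] once the [n] new vertices have
    joined [S], which already holds the start. *)
Definition path_mass y S n a : R :=
  q * (M ^+ #|~: S| / M ^+ n.+2 *
    (q * (q + 2 * N%:R * w2 +
       (k S (~~ comm y) + (if comm y then n%:R - a%:R else a%:R)) * (w1 - w2)))).

(** Iterating [separate_rec] moves [x] along a walk whose past joins [S]. Self-avoidance bounds its
    length, so any [L] at least the number of free vertices suffices. *)
Lemma separate_mass L S x y : x \notin S -> y \notin S -> x != y ->
  (#|~: S| <= L)%N ->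
  rooted_sum arc S (fun r => [&& r x \notin S, r y \notin S & r x != r y]) =
  walk_sum L (comm x) (cnt (~: (y |: (x |: S))) true)
    (cnt (~: (y |: (x |: S))) false) (path_mass y (x |: S)).
Proof.
have cardC (T : {set V}) z : z \notin T -> #|~: T| = #|~: (z |: T)|.+1.
  move=> zT; rewrite (cardsD1 z) inE zT add1n; congr #|pred_of_set _|.+1.
  by apply/setP => u; rewrite !inE negb_or.
elim: L S x => [|L IH] S x xS yS xy le_L.
  by move: le_L; rewrite (cardC S x).
have M0 := total_rate_neq0.
have yxS : y \notin x |: S by rewrite in_setU1 negb_or eq_sym xy.
rewrite (separate_rec xS yS xy) walk_sumS; congr (_ + _).
  have [_ -> // _] := forest_masses (x |: S).
  by rewrite /path_mass /escape_mass; case: (comm y); rewrite ?subrr addr0.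
pose A := cnt (~: (y |: (x |: S))).
rewrite (cnt_setC _ true) (cnt_setC _ false) -/(A true) -/(A false).
(* Booleans are read as numbers: a step into community [c] removes one vertex from the pool of [c]
   and counts as a visit to [true] exactly when [c] holds. *)
pose phi c := walk_sum L c (A true - c) (A false - ~~ c)
  (fun n a => path_mass y (x |: S) n.+1 (c + a)).
rewrite -!subn1 -[in X in _ = X + _](subn0 (A false)) -[in X in _ = _ + X](subn0 (A true)).
rewrite -(sum_outside _ (fun c => type_weight (comm x) c * phi c)).
(* A step to [y] contributes nothing, since the two roots would then coincide; hence the pools
   exclude [y]. *)
rewrite (bigD1 y) /=; last by rewrite inE.
rewrite [X in _ * X + _](_ : _ = 0); last first.
  rewrite -(rooted_sum0 arc (x |: S)); apply: eq_rooted_sum => f _ _.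
  by rewrite eqxx !andbF.
rewrite mulr0 add0r; apply: eq_big => [z|z /andP[zxS zy]].
  by rewrite !inE !negb_or andbC.
have {}zxS : z \notin x |: S by move: zxS; rewrite inE.
have zx : (z == x) = false by apply: contraNF zxS => /eqP ->; exact: setU11.
rewrite /arc zx IH // -1?ltnS -1?cardC // /phi; congr (_ * _).
have zyxS : z \notin y |: (x |: S) by rewrite in_setU1 negb_or zy.
have cntA c : cnt (~: (y |: (z |: (x |: S)))) c = (A c - (comm z == c))%N.
  rewrite finset.setUCA /A; set T := y |: _.
  have -> : ~: T = z |: ~: (z |: T).
    apply/setP => u; rewrite in_setU1 !finset.in_setC in_setU1.
    by have [->|] := eqVneq u z; rewrite /= ?zyxS.
  by rewrite [in RHS]cnt_setU1 ?addKn // !inE eqxx.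
rewrite !cntA eqb_id eqbF_neg; apply: eq_walk_sum => n a le_an.
have ratio m p : M ^+ m.+1 / M ^+ p.+1 = M ^+ m / M ^+ p.
  by rewrite !exprS invfM mulrACA divff // mul1r.
rewrite /path_mass (cardC _ _ zxS) (ratio _ n.+2).
congr (_ * (_ * (_ * (_ + _ * _)))); rewrite cnt_setU1 //.
by case: (comm y); case: (comm z); rewrite /= ?natrD; ring.
Qed.

Lemma spanning_mass0 : rooted_sum arc finset.set0 predT =
  M ^+ #|V| / M ^+ 2 * (q * (q + 2 * N%:R * w2)).
Proof.
have [-> _ _] := forest_masses finset.set0.
rewrite finset.setC0 cardsT; congr (_ * _).
by rewrite /spanning_mass !cnt_set0; ring.
Qed.

End TwoCommunities.

(** * Local times of a finite Markov chain *)

Section MarkovChain.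
Context d (Omega : measurableType d) (R : realType) (P : probability Omega R).
Local Open Scope classical_set_scope.

Lemma measure_fibers (I : finType) (X : Omega -> I) (E : set Omega) :
  (forall i, measurable (E `&` X @^-1` [set i])) ->
  measurable E /\ P E = (\sum_i P (E `&` X @^-1` [set i]))%E.
Proof.
move=> mE.
have EE : E = \bigcup_(i in [set: I]) (E `&` X @^-1` [set i]).
  by apply/seteqP; split=> [om Eom|om [i _ []] //]; exists (X om).
rewrite [in measurable E]EE [in LHS]EE; split.
  by apply: fin_bigcup_measurable.
rewrite measure_fin_bigcup //; first last.
- by move=> i j _ _ [om [[_ <-] [_ <-]]].
- exact: finite_finset.
rewrite (_ : setT = [set` predT]); last by apply/seteqP; split.
by rewrite -(bigfs _ (index_enum_uniq I)) // => i _; rewrite mem_index_enum.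
Qed.

Context (r : nat) (A : 'M[R]_r) (s : 'I_r).

(* Probability that, among the n steps after a visit to c, exactly a lead to s. *)
Fixpoint visit_law n a c : R :=
  if n is n'.+1 then
    (\sum_c' A c c' * (if c' == s then if a is a'.+1 then visit_law n' a' c' else 0
                      else visit_law n' a c'))%R
  else (a == 0%N)%:R.

Definition prefix_event (X : nat -> Omega -> 'I_r) m (t : nat -> 'I_r) : set Omega :=
  [set om | forall j, (j <= m)%N -> X j om = t j].

(** The Markov property speaks of whole prefixes, so the induction on [n] carries an arbitrary
    prefix and extends it by the next state. *)
Lemma prefix_visits i0 X m n a t : is_markov_chain P i0 A X ->
  let E := prefix_event X m t `&`
    [set om | (\sum_(m.+1 <= j < m.+1 + n) (X j om == s))%N = a] in
  measurable E /\ P E = (P (prefix_event X m t) * (visit_law n a (t m))%:E)%E.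
Proof.
case=> mX _ stepX.
have mpre m' t' : measurable (prefix_event X m' t').
  elim: m' => [|m' IH].
    rewrite (_ : prefix_event _ _ _ = X 0%N @^-1` [set t' 0%N]); first exact: mX.
    apply/seteqP; split=> [om /(_ 0%N (leqnn _)) //|om /= e j].
    by rewrite leqn0 => /eqP ->.
  rewrite (_ : prefix_event _ _ _ =
    prefix_event X m' t' `&` X m'.+1 @^-1` [set t' m'.+1]).
    by apply: measurableI; [exact: IH | exact: mX].
  apply/seteqP; split=> [om e|om [e e'] j].
    by split=> [j jm|]; apply: e => //; exact: leqW.
  by rewrite leq_eqVlt => /predU1P[-> //|]; exact: e.
elim: n m a t => [|n IH] m a t /=.
  rewrite addn0; case: a => [|a].
    rewrite (_ : [set om | _] = setT) ?setIT ?mule1 //.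
    by apply/seteqP; split=> // om _ /=; rewrite big_geq.
  rewrite (_ : [set om | _] = classical_sets.set0) ?setI0 ?measure0 ?mule0 //.
  by apply/seteqP; split=> // om /=; rewrite big_geq.
set E := _ `&` _.
pose t' c := fun j => if j == m.+1 then c else t j.
have fiber c : measurable (E `&` X m.+1 @^-1` [set c]) /\
    P (E `&` X m.+1 @^-1` [set c]) =
    (P (prefix_event X m t) * (A (t m) c * (if c == s then
       if a is a'.+1 then visit_law n a' c else 0 else visit_law n a c))%:E)%E.
  have pre_c b : (P (prefix_event X m.+1 (t' c)) * (visit_law n b c)%:E =
      P (prefix_event X m t) * (A (t m) c * visit_law n b c)%:E)%E.
    rewrite stepX /t' eqxx -muleA -EFinM ltn_eqF //; congr (P _ * _)%E.
    apply/seteqP; split=> om /= e j jm; have := e j jm; rewrite ifN // ?neq_ltn ltnS jm //.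
  have sumS om : (\sum_(m.+1 <= j < m.+1 + n.+1) (X j om == s) =
      (X m.+1 om == s) + \sum_(m.+2 <= j < m.+2 + n) (X j om == s))%N.
    by rewrite -addSnnS big_ltn // leq_addr.
  have fib : E `&` X m.+1 @^-1` [set c] = prefix_event X m.+1 (t' c) `&`
      [set om | ((c == s) + \sum_(m.+2 <= j < m.+2 + n) (X j om == s))%N = a].
    apply/seteqP; split=> [om [[e]]|om [e]]; rewrite /mkset; last first.
      have ec := e m.+1 (leqnn _); rewrite /t' eqxx in ec; rewrite -ec => ea.
      split=> //; split=> [j jm|]; last by rewrite /mkset sumS.
      by rewrite e ?leqW // /t' ltn_eqF.
    rewrite sumS => ea ec; have {}ec : X m.+1 om = c by [].
    split; last by rewrite /mkset -ec.
    by move=> j; rewrite /t' leq_eqVlt; case: eqP => [-> //|_ /= jm]; exact: e.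
  rewrite fib; have [cs|cs] := eqVneq c s; last first.
    by rewrite -pre_c; have := IH m.+1 a (t' c); rewrite /t' eqxx.
  case: a @E fib => [|a] E _.
    rewrite (_ : [set om | _] = classical_sets.set0) ?setI0 ?measure0 ?mulr0 ?mule0 //.
    by apply/seteqP; split=> // om /=.
  rewrite -pre_c; have := IH m.+1 a (t' c); rewrite /t' eqxx.
  rewrite (_ : [set om | (true + _)%N = _] =
    [set om | (\sum_(m.+2 <= j < m.+2 + n) (X j om == s))%N = a]) //.
  by apply/seteqP; split=> om /=; rewrite add1n; [case|move=> ->].
have [mE ->] := measure_fibers (fun c => (fiber c).1); split=> //.
rewrite (eq_bigr _ (fun c _ => (fiber c).2)).
rewrite -(fineK (fin_num_measure P _ (mpre m t))) -EFinM mulr_sumr -sumEFin.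
by apply: eq_bigr => c _; rewrite -EFinM.
Qed.

(** The local time includes time 0, where the chain is almost surely at [i0]; this accounts for the
    shift by [i0 == s]. The fibres over other initial states are null. *)
Lemma local_time_law i0 X n a : is_markov_chain P i0 A X ->
  P [set om | local_time X s n.+1 om = ((i0 == s) + a)%N] = (visit_law n a i0)%:E.
Proof.
move=> chain; have [mX X0 _] := chain.
have fiber c : measurable ([set om | local_time X s n.+1 om = ((i0 == s) + a)%N] `&`
      X 0%N @^-1` [set c]) /\
    P ([set om | local_time X s n.+1 om = ((i0 == s) + a)%N] `&` X 0%N @^-1` [set c]) =
    (if c == i0 then (visit_law n a i0)%:E else 0)%E.
  have pre c' : prefix_event X 0 (fun=> c') = X 0%N @^-1` [set c'].
    apply/seteqP; split=> [om /(_ 0%N (leqnn _)) //|om /= e j].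
    by rewrite leqn0 => /eqP ->.
  have fib b : ((i0 == s) + a = (c == s) + b)%N ->
      [set om | local_time X s n.+1 om = ((i0 == s) + a)%N] `&` X 0%N @^-1` [set c] =
      prefix_event X 0 (fun=> c) `&`
        [set om | (\sum_(1 <= j < 1 + n) (X j om == s))%N = b].
    have ltE om : X 0%N om = c -> local_time X s n.+1 om =
        ((c == s) + \sum_(1 <= j < 1 + n) (X j om == s))%N.
      by move=> <-; rewrite /local_time big_ltn.
    move=> ->; rewrite pre setIC; apply/seteqP; split=> om [ec e]; split=> //.
      by apply/eqP; rewrite -(eqn_add2l (c == s)) -ltE //; apply/eqP.
    by rewrite /mkset ltE // e.
  have [ci0|ci0] := eqVneq c i0.
    have /fib -> : ((i0 == s) + a = (c == s) + a)%N by rewrite ci0.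
    have [mE ->] := prefix_visits 0 n a (fun=> c) chain; split=> //.
    by rewrite pre ci0 X0 mul1e.
  have P0 : P (X 0%N @^-1` [set c]) = 0%E.
    apply: (@subset_measure0 _ _ _ _ _ (~` (X 0%N @^-1` [set i0]))).
    - exact: mX.
    - by apply: measurableC; exact: mX.
    - by move=> om /= ->; exact/eqP.
    - by have := probability_setC P (mX 0%N i0); rewrite X0 subee.
  case: (leqP (c == s) ((i0 == s) + a)) => [le|lt].
    have /fib -> : ((i0 == s) + a = (c == s) + ((i0 == s) + a - (c == s)))%N.
      by rewrite subnKC.
    have [mE ->] := prefix_visits 0 n ((i0 == s) + a - (c == s)) (fun=> c) chain.
    by split; rewrite // pre P0 mul0e.
  rewrite (_ : _ `&` _ = classical_sets.set0) ?measure0 //.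
  apply/seteqP; split=> // om [+ ec]; rewrite /mkset /local_time big_ltn //.
  by rewrite (_ : X 0%N om = c) // => e; move: lt; rewrite -e ltnNge leq_addr.
have [_ ->] := measure_fibers (fun c => (fiber c).1).
by rewrite (eq_bigr _ (fun c _ => (fiber c).2)) -big_mkcond big_pred1_eq.
Qed.

End MarkovChain.

(** * The pairwise interaction potential *)

Lemma lep_potentialE d (Omega : measurableType d) (R : realType)
    (P : probability Omega R) (V : finType) (G : wgraph R V) (q : R)
    (Pi : Omega -> {set {set V}}) (x y : V) :
  is_wgraph G -> is_lep P G q Pi ->
  lep_potential P Pi x y =
    (\sum_(f | spanning G f) pweight (arc_weight G q) finset.set0 f)^-1 *
    \sum_(f | spanning G f && (root_of f x != root_of f y))
      pweight (arc_weight G q) finset.set0 f.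
Proof.
move=> wG [mPi lawPi].
pose sep (pi : {set {set V}}) := finset.pblock pi x != finset.pblock pi y.
have fiber pi : measurable ([set om | sep (Pi om)] `&` Pi @^-1` [set pi])%classic /\
    P ([set om | sep (Pi om)] `&` Pi @^-1` [set pi])%classic =
    (if sep pi then lep_law G q pi else 0)%:E.
  case: ifPn => sep_pi.
    rewrite (_ : _ `&` _ = Pi @^-1` [set pi])%classic //.
    by apply/seteqP; split=> [om []|om /= e] //; rewrite e.
  rewrite (_ : (_ `&` _)%classic = classical_sets.set0) ?measure0 //.
  by apply/seteqP; split=> // om [/= + e]; rewrite e (negPf sep_pi).
rewrite /lep_potential (measure_fibers P (fun pi => (fiber pi).1)).2.
rewrite (eq_bigr _ (fun pi _ => (fiber pi).2)) sumEFin /= -big_mkcond /=.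
rewrite /lep_law -mulr_sumr /lep_Z.
have -> : \sum_(F : {set rtree V} | `[< is_forest G F >]) q ^+ #|F| * forest_weight G F =
    \sum_(f | spanning G f) pweight (arc_weight G q) finset.set0 f.
  transitivity (\sum_(F : {set rtree V} | `[< is_forest G F >] && predT F)
    q ^+ #|F| * forest_weight G F); first by apply: eq_bigl => F; rewrite andbT.
  by rewrite sum_forests //; apply: eq_bigl => f; rewrite andbT.
congr (_ * _).
transitivity (\sum_(F : {set rtree V} | `[< is_forest G F >] && sep (forest_partition F))
    q ^+ #|F| * forest_weight G F).
  rewrite [RHS](partition_big (@forest_partition V) sep) /=; last by move=> F /andP[].
  apply: eq_bigr => pi sep_pi; apply: eq_bigl => F; rewrite -andbA; congr (_ && _).
  by case: eqP => [->|]; rewrite ?sep_pi ?andbF.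
rewrite (sum_forests _ (fun F => sep (forest_partition F))) //; apply: eq_bigl => f.
by case: (boolP (spanning G f)) => //= /andP[rf _]; rewrite /sep forest_of_pblock.
Qed.

(** * Specialisation to the two-community graph and matching of the formulas *)

Lemma card_community1 N c : #|[set u | (u \in community1 N) == c]%SET| = N.
Proof.
have le : (N <= 2 * N)%N by rewrite leq_pmull.
have inj : injective (widen_ord le) by move=> i j [/val_inj].
have C1 : #|community1 N| = N.
  rewrite -[RHS]card_ord -(card_imset _ inj).
  apply: eq_card => u; rewrite inE; apply/idP/imsetP => [uN|[i _ ->] /=]; last exact: ltn_ord.
  by exists (Ordinal uN) => //; exact: val_inj.
case: c; first by rewrite -[RHS]C1; apply: eq_card => u; rewrite !inE eqb_id.
rewrite (_ : [set u | _]%SET = ~: community1 N); last first.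
  by apply/setP => u; rewrite !inE eqbF_neg.
by rewrite cardsCs finset.setCK C1 card_ord mul2n -addnn addnK.
Qed.

Lemma two_community_arc (R : realType) N (q w1 w2 : R) (u z : 'I_(2 * N)) :
  arc_weight (two_community_graph N w1 w2) q u z =
  arc (fun v => v \in community1 N) q w1 w2 u z.
Proof.
rewrite /arc_weight /arc /type_weight /=; case: ifP => // _.
rewrite !finset.subUset !finset.sub1set !finset.in_setC.
by case: (u \in _); case: (z \in _).
Qed.

Lemma two_community_spanning (R : realType) N (w1 w2 : R) (f : {ffun 'I_(2 * N) -> 'I_(2 * N)}) :
  spanning (two_community_graph N w1 w2) f = rooted f.
Proof.
rewrite /spanning andbC; case: forallP => // -[] u; apply/implyP => fu.
by rewrite inE cards2 [u == _]eq_sym fu.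
Qed.

(** Type weights are [w1 + w2] times the transition probabilities of [tilde_P], once per step, with
    [ord0] read as [true]. *)
Lemma visit_law_walk_weight (R : realType) (w1 w2 : R) n a (c : 'I_2) :
  w1 + w2 != 0 ->
  visit_law (tilde_P w1 w2) ord0 n a c * (w1 + w2) ^+ n =
  walk_weight w1 w2 n a (c == ord0).
Proof.
move=> w0; elim: n a c => [|n IH] a c; first by rewrite mulr1.
have step c' : tilde_P w1 w2 c c' * (w1 + w2) =
    type_weight w1 w2 (c == ord0) (c' == ord0).
  rewrite mxE /type_weight; case: c c' => [[|[|//]] ?] [[|[|//]] ?] /=; by field.
rewrite /= big_ord_recl big_ord1 /= exprSr.
have stepE c' v u : v * (w1 + w2) ^+ n = u ->
    tilde_P w1 w2 c c' * v * ((w1 + w2) ^+ n * (w1 + w2)) =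
    type_weight w1 w2 (c == ord0) (c' == ord0) * u.
  by move=> <-; rewrite -step; ring.
rewrite mulrDl; congr (_ + _); apply: stepE; last exact: IH.
by case: a => [|a]; rewrite ?mul0r ?IH.
Qed.

(** The numerator of [theta] equals the denominator of [P_dagger], so both cancel. The bounds on [k]
    and [n - k] make the radicand nonnegative and this denominator positive. *)
Lemma theta_P_dagger (R : realType) (q w1 w2 : R) star N n k :
  0 < q -> 0 < w1 -> 0 < w2 -> (k <= n)%N -> (k <= N)%N -> (n - k <= N)%N ->
  theta q w1 w2 N n k * P_dagger star q w1 w2 N n k =
  (q + k_star R star n k * (w1 - w2) + 2 * w2 * N%:R) / (q + 2 * N%:R * w2).
Proof.
move=> q0 w10 w20 kn kN nkN.
have [b nE] : exists b, n = (k + b)%N by exists (n - k)%N; rewrite subnKC.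
subst n; rewrite addKn in nkN; rewrite /theta /P_dagger natrD.
have [[q1 w11] w21] := (ltW q0, ltW w10, ltW w20).
have kR : 0 <= k%:R :> R by [].
have bR : 0 <= b%:R :> R by [].
have kNR : k%:R <= N%:R :> R by rewrite ler_nat.
have bNR : b%:R <= N%:R :> R by rewrite ler_nat.
set K : R := k%:R in kR kNR *; set B : R := b%:R in bR bNR *; set M : R := N%:R in kNR bNR *.
have lambdaE : (q - lambda w1 w2 N 1 (k + b) k) * (q - lambda w1 w2 N 2 (k + b) k) =
    (q + K * w1) * (q + (K + B - K) * w1) + M * w2 * (2 * q + (K + B) * w1) +
    w2 ^+ 2 * (M * (K + B) - K * (K + B - K)).
  rewrite /lambda natrD -/K -/B -/M; set r := (X in Num.sqrt X).
  have r0 : 0 <= r.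
    have -> : r = (w1 * (K - B)) ^+ 2 + 4 * (M - K) * (M - B) * w2 ^+ 2 by rewrite /r; ring.
    by rewrite addr_ge0 ?sqr_ge0 // !mulr_ge0 ?sqr_ge0 ?subr_ge0 ?ler0n.
  have := sqr_sqrtr r0; set s := Num.sqrt r => s2.
  transitivity ((q + (w1 * (K + B) + 2 * w2 * M) / 2) ^+ 2 - s ^+ 2 / 4).
    by field.
  by rewrite s2 /r; field.
rewrite lambdaE; set D := (X in X / _ * _).
have D0 : D != 0.
  (* Regrouped so that every term is visibly nonnegative and the first one positive. *)
  have -> : D = q * q + (q * B * w1 + K * w1 * q + K * w1 * B * w1 +
      M * w2 * (2 * q + (K + B) * w1) + w2 ^+ 2 * (K * (M - B) + M * B)).
    by rewrite /D; ring.
  rewrite gt_eqF // ltr_pwDl ?mulr_gt0 //.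
  by do ?[by rewrite subr_ge0 | exact: ler0n | apply: addr_ge0 | apply: mulr_ge0].
rewrite [X in _ * (_ / X) = _](_ : _ = D) //; field.
rewrite D0 (gt_eqF q0) /= gt_eqF // ltr_pwDl // !mulr_ge0 ?ler0n // ltW.
Qed.


Theorem theorem2 (R : realType) (N : nat) (q w1 w2 : R)
  (q_gt0 : 0 < q) (w1_gt0 : 0 < w1) (w2_gt0 : 0 < w2)
  (* the loop-erased partition of the two-community graph *)
  (d : measure_display) (Omega : measurableType d) (P : probability Omega R)
  (Pi : Omega -> {set {set 'I_(2 * N)}})
  (Pi_lep : is_lep P (two_community_graph N w1 w2) q Pi)
  (* the geometric time *)
  (dT : measure_display) (OmegaT : measurableType dT)
  (PT : probability OmegaT R) (T : {RV PT >-> nat})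
  (T_geom : is_geometric T (xi_q q w1 w2 N))
  (* the chain started from \underline{1} *)
  (dX : measure_display) (OmegaX : measurableType dX)
  (PX : probability OmegaX R) (X : nat -> OmegaX -> 'I_2)
  (X_chain : is_markov_chain PX ord0 (tilde_P w1 w2) X)
  (x y : 'I_(2 * N)) (x_in : x \in community1 N) (yx : y != x) :
  let star := position_of y in
  ((fun M : nat =>
     \sum_(1 <= n < M)
       fine (PT (T @^-1` [set n])) *
       \sum_(1 <= k < n.+1)
         fine (PX [set om | local_time X ord0 n om = k]) *
         N%:R ^- (n - 1) * (f_hat star N n k)%:R *
         theta q w1 w2 N n k * P_dagger star q w1 w2 N n k)
    @ \oo --> lep_potential P Pi x y)%classic.
Proof.
move=> star; pose comm (u : 'I_(2 * N)) := u \in community1 N.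
pose M := total_rate N q w1 w2.
have cardN : forall c, #|[set u | comm u == c]%SET| = N := @card_community1 N.
have M0 : M != 0 by exact: total_rate_neq0.
have w0 : w1 + w2 != 0 by rewrite gt_eqF // addr_gt0.
have N_gt0 : (0 < N)%N.
  by have := leq_ltn_trans (leq0n x) (ltn_ord x); rewrite muln_gt0 => /andP[].
have N0 : N%:R != 0 :> R.
  by rewrite pnatr_eq0 -lt0n.
have qN0 : q + 2 * N%:R * w2 != 0.
  by rewrite gt_eqF // ltr_pwDl // !mulr_ge0 ?ler0n // ltW.
have xy : x != y by rewrite eq_sym.
have arcE f : pweight (arc_weight (two_community_graph N w1 w2) q) finset.set0 f =
    pweight (arc comm q w1 w2) finset.set0 f.
  by apply: eq_bigr => u _; exact: two_community_arc.
have x0 : x \notin finset.set0 by rewrite inE.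
have y0 : y \notin finset.set0 by rewrite inE.
have potentialE L : (2 * N <= L)%N -> lep_potential P Pi x y =
    (M ^+ (2 * N) / M ^+ 2 * (q * (q + 2 * N%:R * w2)))^-1 *
    walk_sum w1 w2 L true (cnt comm (~: (y |: (x |: finset.set0))) true)
      (cnt comm (~: (y |: (x |: finset.set0))) false)
      (path_mass comm N q w1 w2 y (x |: finset.set0)).
  move=> le_L.
  rewrite (lep_potentialE x y (two_community_is_wgraph N w1_gt0 w2_gt0) Pi_lep).
  have := spanning_mass0 q_gt0 w1_gt0 w2_gt0 cardN.
  rewrite card_ord => <-.
  have := separate_mass q_gt0 w1_gt0 w2_gt0 cardN x0 y0 xy (L := L).
  rewrite finset.setC0 cardsT card_ord (_ : comm x = true) // => /(_ le_L) <-.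
  have fixes0 f : fixes finset.set0 f by apply/fixesP => u; rewrite inE.
  congr (_^-1 * _); rewrite /rooted_sum; apply: eq_big => f //;
    by rewrite two_community_spanning fixes0 ?andbT ?inE.
(* By [potentialE] the partial sums are constant once they cover all self-avoiding walks. *)
apply: cvg_near_cst; near=> L1.
have [L L1E] : exists L, L1 = L.+1.
  by exists L1.-1; rewrite prednK //; near: L1; exact: nbhs_infty_gt.
have le_L : (2 * N <= L)%N.
  by rewrite -ltnS -L1E; near: L1; exact: nbhs_infty_gt.
(* Both indices shift by one: a walk with [n] steps matches the value [n.+1] of the geometric time,
   and the start [x] itself counts as a visit to state 1. *)
rewrite (potentialE L le_L) L1E big_add1 big_mkord /walk_sum mulr_sumr.
apply: eq_bigr => n _; rewrite big_add1 big_mkord !mulr_sumr.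
apply: eq_bigr => a _.
have lawE := local_time_law ord0 n a X_chain; rewrite eqxx add1n in lawE.
rewrite lawE T_geom //= (_ : true = (ord0 == ord0 :> 'I_2)) //.
rewrite -visit_law_walk_weight // eqxx.
set A1 := cnt _ _ true; set A2 := cnt _ _ false.
have xE : comm x = true by [].
have yx0 : y \notin x |: finset.set0 by rewrite in_setU1 negb_or yx.
have cntE c : cnt comm (~: (y |: (x |: finset.set0))) c = (N - ((comm y == c) + (true == c)))%N.
  rewrite -[in RHS](cntC cardN (y |: (x |: finset.set0)) c).
  by rewrite !cnt_setU1 // cnt_set0 xE addn0 addKn.
have f_hatE : f_hat star N n.+1 a.+1 = (A1 ^_ a * A2 ^_ (n - a))%N.
  rewrite /A1 /A2 !cntE /star /position_of -/(comm y); case: (comm y) => /=;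
  by rewrite !subn1 ?subn0 ?addn0 ?subSS.
have leaN : (a <= n)%N by rewrite -ltnS; exact: ltn_ord.
(* Vanishing terms are set apart, because only a nonzero product of falling factorials gives the
   bounds required by [theta_P_dagger]. *)
have [f0|] := posnP (A1 ^_ a * A2 ^_ (n - a)).
  rewrite f_hatE f0 mulr0n mulr0 !mul0r mulr0.
  by rewrite -[_ * _ * (A2 ^_ _)%:R]mulrA -(natrM _ (A1 ^_ a)) f0 mulr0n mulr0 mul0r mulr0.
rewrite muln_gt0 !ffact_gt0 => /andP[aA1 aA2].
have aN : (a.+1 <= N)%N.
  rewrite -(prednK N_gt0) ltnS; apply: leq_trans aA1 _.
  by rewrite /A1 cntE -subn1 leq_sub2l // leq_addl.
have naN : (n.+1 - a.+1 <= N)%N.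
  by rewrite subSS; apply: leq_trans aA2 _; rewrite /A2 cntE leq_subr.
have thetaE := theta_P_dagger star q_gt0 w1_gt0 w2_gt0 (leaN : (a.+1 <= n.+1)%N) aN naN.
rewrite -[_ * P_dagger _ _ _ _ _ _ _]mulrA thetaE f_hatE natrM.
have -> : path_mass comm N q w1 w2 y (x |: finset.set0) n a =
    q * (M ^+ (2 * N).-1 / M ^+ n.+2 *
      (q * (q + k_star R star n.+1 a.+1 * (w1 - w2) + 2 * w2 * N%:R))).
  rewrite /path_mass (_ : #|~: (x |: finset.set0)| = (2 * N).-1); last first.
    by rewrite finset.setU0 cardsC1 card_ord.
  rewrite !cnt_setU1 // cnt_set0 xE /star /position_of -/(comm y) -/M.
  by congr (_ * (_ * (_ * _))); case: (comm y); rewrite /= ?addn0 ?mulrS; ring.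
have [m mE] : exists m, (2 * N)%N = m.+1 by exists (2 * N).-1; rewrite prednK // muln_gt0.
rewrite mE /= subn1 /= /xi_q (_ : q + N%:R * (w1 + w2) = M) //.
(* The power of this factor supplies the power of N that cancels the negative one in the formula,
   and the power of [w1 + w2] that relates [visit_law] to [walk_weight]. *)
have -> : 1 - q / M = N%:R * (w1 + w2) / M.
  by apply/(mulIf M0); rewrite mulrBl !divfK // mul1r addrC addKr.
rewrite !exprMn exprVn (exprS M m) (exprS M n.+1) (exprS M n).
field; by rewrite !expf_neq0 // M0 qN0 gt_eqF.
Unshelve. all: by end_near.
Qed.
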